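(* Let $A\in\mathbb{C}^{n\times n}$ be a Hermitian matrix, and let the columns of the matrices $X,Y\in\mathbb{C}^{n\times p}$ form orthonormal bases of subspaces $\mathcal{X}$ and $\mathcal{Y}$ of $\mathbb{C}^n$, respectively, with $\dim(\mathcal{X})=\dim(\mathcal{Y})=p$. Assume $\Theta(\mathcal{X},\mathcal{Y})<\pi/2$ (all principal angles are less than $\pi/2$). Let $c=\cos(\theta_{\min}(\mathcal{X},\mathcal{Y}))/\cos(\theta_{\max}(\mathcal{X},\mathcal{Y}))$. Then $$\left|\Lambda(X^HAX)-\Lambda(Y^HAY)\right|\prec_w \sqrt{c}\,\frac{\left\{S(P_{\mathcal{Y}}R_X)+S(P_{\mathcal{X}}R_Y)\right\}}{\cos(\Theta^{\downarrow}(\mathcal{X},\mathcal{Y}))}.$$ If the subspace $\mathcal{X}$ is $A$-invariant, then $$\left|\Lambda(X^HAX)-\Lambda(Y^HAY)\right|\prec_w \sqrt{c}\,\frac{S(P_{\mathcal{X}}R_Y)}{\cos(\Theta^{\downarrow}(\mathcal{X},\mathcal{Y}))}.$$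
   Context: $\Lambda(\cdot)$ is the vector of eigenvalues of a Hermitian matrix in decreasing order. $S(\cdot)$ is the vector of singular values of a matrix in decreasing order (for an $n\times p$ matrix with $p\le n$, it has $p$ entries). $R_X=AX-X(X^HAX)$ and $R_Y=AY-Y(Y^HAY)$ are the residual matrices. $P_{\mathcal{X}}$, $P_{\mathcal{Y}}$ are the orthogonal projectors onto $\mathcal{X}$, $\mathcal{Y}$. The principal angles between $\mathcal{X}$ and $\mathcal{Y}$ lie in $[0,\pi/2]$ and are the numbers whose cosines are the singular values of $X^HY$; $\Theta(\mathcal{X},\mathcal{Y})=\Theta^{\downarrow}(\mathcal{X},\mathcal{Y})$ is the vector of these $p$ angles in decreasing order, and $\theta_{\max}(\mathcal{X},\mathcal{Y})$, $\theta_{\min}(\mathcal{X},\mathcal{Y})$ are the largest and smallest of them. A subspace $\mathcal{X}$ is $A$-invariant if $A\mathcal{X}\subset\mathcal{X}$. All operations on vectors (sum, product, quotient, absolute value, cosine) are entry-wise, in the given orderings. For $x,y\in\mathbb{R}^m$, $x\prec_w y$ (weak majorization) means that, after rearranging the entries of each vector in decreasing order $x_1\ge\dots\ge x_m$, $y_1\ge\dots\ge y_m$, one has $\sum_{i=1}^k x_i\le\sum_{i=1}^k y_i$ for all $1\le k\le m$. *)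

(* Defs.v *)
From mathcomp Require Import all_boot all_order all_algebra.
From mathcomp Require Import sesquilinear spectral.
From mathcomp Require Import complex.
From mathcomp Require Import reals trigo.

Set Implicit Arguments.
Unset Strict Implicit.
Unset Printing Implicit Defensive.

Import Order.TTheory GRing.Theory Num.Theory.
Local Open Scope ring_scope.
Local Open Scope complex_scope.
Local Open Scope sesquilinear_scope.

Definition dsort (R : realType) (m : nat) (x : 'rV[R]_m) : 'rV[R]_m :=
  \row_(i < m) nth 0 (sort >=%R [seq x 0 j | j <- enum 'I_m]) i.

Definition weak_majorized (R : realType) (m : nat) (x y : 'rV[R]_m) : Prop :=
  forall k : nat, (1 <= k <= m)%N ->
    \sum_(i < m | (i < k)%N) dsort x 0 i <= \sum_(i < m | (i < k)%N) dsort y 0 i.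

(* For Hermitian A the entries of spectral_diag A are the eigenvalues of A
   with multiplicity; they are real elements of R[i], so that complex.Re merely
   changes their type (see char_poly_Lambda below). *)
Definition Lambda (R : realType) (m : nat) (A : 'M[R[i]]_m) : 'rV[R]_m :=
  dsort (\row_(j < m) complex.Re (spectral_diag A 0 j)).

(* The p singular values of a matrix with p columns and at least p rows. *)
Definition singvals (R : realType) (m p : nat) (M : 'M[R[i]]_(m, p)) : 'rV[R]_p :=
  dsort (\row_(j < p) Num.sqrt (Lambda (M ^t* *m M) 0 j)).

(* Subspaces are the column spaces of matrices, whereas mxalgebra and spectral
   work with row spaces and matrices acting on the right: hence the
   transpositions. *)
Definition orth_proj (R : realType) (n p : nat) (X : 'M[R[i]]_(n, p)) :
    'M[R[i]]_n :=
  (proj_ortho X^T)^T.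

Definition invariant_colspace (R : realType) (n p : nat) (A : 'M[R[i]]_n)
    (X : 'M[R[i]]_(n, p)) : Prop :=
  ((A *m X)^T <= X^T)%MS.

(* The columns of X are orthonormal for the standard inner product. *)
Definition orthonormal_cols (R : realType) (n p : nat)
    (X : 'M[R[i]]_(n, p)) : Prop :=
  X ^t* *m X = 1%:M.

Definition residual (R : realType) (n p : nat) (A : 'M[R[i]]_n)
    (X : 'M[R[i]]_(n, p)) : 'M[R[i]]_(n, p) :=
  A *m X - X *m (X ^t* *m A *m X).

(* Principal angles between the column spaces of X and Y, whose columns are
   assumed orthonormal. *)
Definition Theta (R : realType) (n p : nat) (X Y : 'M[R[i]]_(n, p)) : 'rV[R]_p :=
  dsort (\row_(j < p) acos (singvals (X ^t* *m Y) 0 j)).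

(* The default values 0 and pi / 2 are the bounds of the range of the angles, so that
   they do not affect the extrema when p > 0. *)
Definition theta_max (R : realType) (n p : nat) (X Y : 'M[R[i]]_(n, p)) : R :=
  \big[Num.max/0]_(j < p) Theta X Y 0 j.

Definition theta_min (R : realType) (n p : nat) (X Y : 'M[R[i]]_(n, p)) : R :=
  \big[Num.min/pi / 2]_(j < p) Theta X Y 0 j.

Section Sanity.
Variable R : realType.

Lemma dsort_perm m (x : 'rV[R]_m) :
  perm_eq [seq dsort x 0 i | i <- enum 'I_m] [seq x 0 i | i <- enum 'I_m].
Proof.
set s := [seq x 0 i | i <- enum 'I_m].
have sz : size (sort >=%R s) = m by rewrite size_sort size_map size_enum_ord.
suff -> : [seq dsort x 0 i | i <- enum 'I_m] = sort >=%R s by rewrite perm_sort.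
apply: (@eq_from_nth _ 0); first by rewrite size_map size_enum_ord sz.
move=> i; rewrite size_map size_enum_ord => lt_im.
rewrite (nth_map (Ordinal lt_im)) ?size_enum_ord//.
by rewrite mxE nth_enum_ord.
Qed.

Lemma dsort_nonincr m (x : 'rV[R]_m) (i j : 'I_m) :
  (i <= j)%N -> dsort x 0 j <= dsort x 0 i.
Proof.
move=> le_ij; rewrite !mxE.
have tr : transitive (>=%R : rel R) by move=> a b c ba cb; exact: le_trans cb ba.
apply: (sorted_leq_nth tr (fun a => lexx a : (a >= a)%R)) => //.
- by apply: (@path.sort_sorted _ (>=%R : rel R)) => a b; exact: le_total.
- by rewrite inE size_sort size_map size_enum_ord.
- by rewrite inE size_sort size_map size_enum_ord.
Qed.

Lemma char_poly_Lambda m (A : 'M[R[i]]_m) : A \is hermsymmx ->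
  char_poly A = \prod_(j < m) ('X - ((Lambda A 0 j)%:C)%:P).
Proof.
move=> Aherm; pose x : 'rV[R]_m := \row_j complex.Re (spectral_diag A 0 j).
transitivity (\prod_(j < m) ('X - ((x 0 j)%:C)%:P)); last first.
  pose F (t : R) : {poly R[i]} := 'X - (t%:C)%:P.
  have toseq (z : 'rV[R]_m) : \prod_(j < m) ('X - ((z 0 j)%:C)%:P) =
      \prod_(t <- [seq z 0 j | j <- enum 'I_m]) F t.
    by rewrite big_map big_enum.
  by rewrite !toseq; apply: perm_big; rewrite perm_sym dsort_perm.
have -> : \prod_(j < m) ('X - ((x 0 j)%:C)%:P) =
          \prod_(j < m) ('X - (spectral_diag A 0 j)%:P).
  apply: eq_bigr => j _; rewrite mxE; congr (_ - _%:P).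
  have /mxOverP/(_ 0 j) := hermitian_spectral_diag_real Aherm.
  exact: RRe_real.
have /orthomx_spectralP {1}-> := hermitian_normalmx Aherm.
have := spectral_unit A; move: (spectralmx A) (spectral_diag A) => P d Pu.
have -> : char_poly (invmx P *m diag_mx d *m P) = char_poly (diag_mx d).
  rewrite /char_poly /char_poly_mx !map_mxM /=.
  set Q := map_mx polyC P; set Q' := map_mx polyC (invmx P).
  have Q'Q : Q' *m Q = 1%:M by rewrite -map_mxM /= mulVmx// map_mx1.
  have -> : 'X%:M - Q' *m map_mx polyC (diag_mx d) *m Q =
            Q' *m ('X%:M - map_mx polyC (diag_mx d)) *m Q.
    by rewrite mulmxBr mulmxBl mul_mx_scalar -scalemxAl Q'Q scalemx1.
  by rewrite !det_mulmx mulrAC -det_mulmx Q'Q det1 mul1r.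
rewrite char_poly_trig; first by apply: eq_bigr => j _; rewrite !mxE eqxx.
exact: diag_mx_is_trig.
Qed.

Lemma orth_projE n p (X : 'M[R[i]]_(n, p)) :
  orthonormal_cols X -> orth_proj X = X *m X ^t*.
Proof.
move=> oX; rewrite /orth_proj -[RHS]trmxK; congr _^T; rewrite trmx_mul.
apply/row_matrixP => i; rewrite !rowE; move: (delta_mx _ _ : 'rV_n) => w.
have XX : X^T *m X^T ^t* = 1%:M.
  rewrite trmxK; apply: trmx_inj; rewrite trmx_mul trmxK trmx1 -[RHS]oX.
  by rewrite map_trmx.
have wX : (w *m ((X ^t*)^T *m X^T) <= X^T)%MS by rewrite mulmxA submxMl.
rewrite -[w in LHS](subrK (w *m ((X ^t*)^T *m X^T))) mulmxDl (proj_ortho_id wX).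
rewrite proj_ortho_0 ?add0r//; apply/orthomx1P.
rewrite mulmxBl -!mulmxA XX mulmx1 !map_trmx !trmxK.
by rewrite subrr.
Qed.

End Sanity.

(* Main.v *)
Require Import Defs.
From mathcomp Require Import all_boot all_order all_algebra.
From mathcomp Require Import fingroup perm.
From mathcomp Require Import sesquilinear spectral.
From mathcomp Require Import complex.
From mathcomp Require Import reals trigo.
From mathcomp Require Import ring lra.

(** Put M = X^* Y, H = X^* A X and K = Y^* A Y. The projected residuals satisfy
    M K - H M = (Y^* R_X)^* - X^* R_Y (residual_sylvester). A singular value
    decomposition of M replaces M by the diagonal matrix S of the cosines of the
    principal angles, and H, K by unitarily equivalent matrices (Theta_frame); let
    E = S K - H S and D = K - H. Then E + E^* = S D + D S.

    By Lidskii's theorem |Lambda H - Lambda K| is weakly majorized by the moduli of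
    the eigenvalues of D (lidskii_majorization), which follows from the monotonicity
    of ordered eigenvalues by cutting D at a suitable level. The sum of the k largest
    of these moduli is tr (D W) for a difference W = P1 - P2 of orthogonal projections
    with P1 + P2 a projection of rank k (kyfan_witness). If B solves the Lyapunov
    equation S B + B S = W, then tr (D W) = 2 Re tr (E B).

    The Lyapunov equation with positive S maps positive right-hand sides to positive
    solutions (psd_lyap). Hence B is a difference of two positive matrices whose sum
    is dominated by S^-1 / 2, and this bounds 2 Re tr (E B) by the sum over i < k of
    s_i (E) / cos theta_i (lyap_trace_bound). Applied separately to the two parts of E
    this gives the majorization with 1 in place of the square root of c
    (sylvester_majorization); the factor c is at least 1 as the smallest angle has the
    largest cosine. When the column space of X is invariant, R_X vanishes. *)

Set Implicit Arguments.
Unset Strict Implicit.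
Unset Printing Implicit Defensive.

Import Order.TTheory GRing.Theory Num.Theory.
Local Open Scope ring_scope.
Local Open Scope complex_scope.
Local Open Scope sesquilinear_scope.

Section RitzMajorization.
Variable R : realType.
Implicit Types m n p : nat.

(** * Hermitian matrices and quadratic forms *)

Lemma adjmxM m n p (A : 'M[R[i]]_(m, n)) (B : 'M[R[i]]_(n, p)) :
  (A *m B) ^t* = B ^t* *m A ^t*.
Proof. by rewrite trmx_mul map_mxM. Qed.

Lemma addmxE (V : nmodType) m n (A B : 'M[V]_(m, n)) i j :
  (A + B) i j = A i j + B i j.
Proof. exact: mxE. Qed.

Lemma oppmxE (V : zmodType) m n (A : 'M[V]_(m, n)) i j : (- A) i j = - A i j.
Proof. exact: mxE. Qed.

Lemma row_fnE (T : Type) n (F : 'I_n -> T) i j : (\row_k F k) i j = F j.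
Proof. exact: mxE. Qed.

Lemma adjmxB m n (A B : 'M[R[i]]_(m, n)) : (A - B) ^t* = A ^t* - B ^t*.
Proof. by rewrite linearB /= map_mxB. Qed.

Lemma adjmxD m n (A B : 'M[R[i]]_(m, n)) : (A + B) ^t* = A ^t* + B ^t*.
Proof. by rewrite linearD /= map_mxD. Qed.

Lemma adjmx1 m : (1%:M : 'M[R[i]]_m) ^t* = 1%:M.
Proof. by rewrite trmx1 map_mx1. Qed.

Definition rdiag m (d : 'rV[R]_m) : 'M[R[i]]_m :=
  diag_mx (map_mx (real_complex R) d).

Lemma rdiagE m (d : 'rV[R]_m) i j : rdiag d i j = (d 0 j)%:C *+ (i == j).
Proof. by rewrite !mxE; case: eqP => [->|]. Qed.

Lemma adj_rdiag m (d : 'rV[R]_m) : (rdiag d) ^t* = rdiag d.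
Proof.
apply/matrixP => i j; rewrite !mxE [j == i]eq_sym.
case: eqP => [->|_]; last exact: conjc0.
exact: conjc_real.
Qed.

Lemma rdiagM m (d e : 'rV[R]_m) :
  rdiag d *m rdiag e = rdiag (\row_j (d 0 j * e 0 j)).
Proof.
rewrite /rdiag mulmx_diag; congr diag_mx.
by apply/rowP => j; rewrite !mxE rmorphM.
Qed.

Lemma rdiagC m (t : R) : rdiag (const_mx t : 'rV_m) = t%:C%:M.
Proof. by apply/matrixP => i j; rewrite rdiagE !mxE. Qed.

Lemma rdiag1 m : rdiag (const_mx 1) = 1%:M :> 'M_m.
Proof. exact: rdiagC. Qed.

Lemma rdiagD m (d e : 'rV[R]_m) : rdiag d + rdiag e = rdiag (d + e).
Proof. by rewrite /rdiag map_mxD linearD. Qed.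

Lemma rdiagN m (d : 'rV[R]_m) : - rdiag d = rdiag (- d).
Proof. by rewrite /rdiag map_mxN linearN. Qed.

Lemma ReD (x y : R[i]) : complex.Re (x + y) = complex.Re x + complex.Re y.
Proof. by case: x => a b; case: y. Qed.

Lemma ReN (x : R[i]) : complex.Re (- x) = - complex.Re x.
Proof. by case: x. Qed.

Lemma Re_conj (x : R[i]) : complex.Re (x^*)%R = complex.Re x.
Proof. by case: x. Qed.

Lemma ReMl (a : R) (x : R[i]) : complex.Re (a%:C * x) = a * complex.Re x.
Proof. by case: x => b c /=; rewrite mul0r subr0. Qed.

Lemma Re_sum (I : Type) (r : seq I) (P : pred I) (F : I -> R[i]) :
  complex.Re (\sum_(i <- r | P i) F i) = \sum_(i <- r | P i) complex.Re (F i).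
Proof. exact: (big_morph (@complex.Re R) ReD (erefl _)). Qed.

Definition normsq (z : R[i]) : R := complex.Re z ^+ 2 + complex.Im z ^+ 2.

Lemma normsq_ge0 z : 0 <= normsq z.
Proof. by rewrite addr_ge0 ?sqr_ge0. Qed.

Lemma normsqE (z : R[i]) : z^* * z = (normsq z)%:C.
Proof.
case: z => a b; rewrite /normsq /=; apply/eqP; rewrite eq_complex /=.
by rewrite mulNr opprK !expr2 mulNr [b * a]mulrC subrr !eqxx.
Qed.

Lemma normsq_eq0 z : normsq z = 0 -> z = 0.
Proof.
case: z => a b /eqP; rewrite /normsq /= paddr_eq0 ?sqr_ge0 // !sqrf_eq0.
by case/andP => /eqP -> /eqP ->.
Qed.

(** Taking the real part keeps all inequalities in the ordered field R; nothing is
    lost for a Hermitian M, whose form is real. *)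
Definition qform m (M : 'M[R[i]]_m) (x : 'cV[R[i]]_m) : R :=
  complex.Re ((x ^t* *m M *m x) 0 0).

Definition psd m (M : 'M[R[i]]_m) : Prop := forall x, 0 <= qform M x.

Lemma psd0 m : psd (0 : 'M[R[i]]_m).
Proof. by move=> x; rewrite /qform mulmx0 mul0mx mxE. Qed.

Lemma qformD m (M N : 'M[R[i]]_m) x : qform (M + N) x = qform M x + qform N x.
Proof. by rewrite /qform mulmxDr mulmxDl mxE ReD. Qed.

Lemma qformN m (M : 'M[R[i]]_m) x : qform (- M) x = - qform M x.
Proof. by rewrite /qform mulmxN mulNmx mxE ReN. Qed.

Lemma qform_conj m n (M : 'M[R[i]]_m) (N : 'M[R[i]]_(m, n)) x :
  qform (N ^t* *m M *m N) x = qform M (N *m x).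
Proof. by rewrite /qform adjmxM !mulmxA. Qed.

Lemma qform_rdiag m (d : 'rV[R]_m) x :
  qform (rdiag d) x = \sum_j d 0 j * normsq (x j 0).
Proof.
rewrite /qform !mxE Re_sum; apply: eq_bigr => j _.
rewrite mul_mx_diag !mxE mulrAC.
rewrite [_ * x j 0]normsqE mulrC ReMl.
by [].
Qed.

Lemma qform1 m x : qform (1%:M : 'M_m) x = \sum_j normsq (x j 0).
Proof.
rewrite -rdiag1 qform_rdiag; apply: eq_bigr => j _.
by rewrite mxE mul1r.
Qed.

Lemma qform1_gt0 m (x : 'cV_m) : x != 0 -> 0 < qform 1%:M x.
Proof.
move=> x0; rewrite lt_neqAle qform1 sumr_ge0 ?andbT; last by move=> *; apply: normsq_ge0.
apply: contraNneq x0 => /esym/eqP; rewrite psumr_eq0; last by move=> *; apply: normsq_ge0.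
move=> /allP h; apply/eqP/colP => j; rewrite mxE; apply: normsq_eq0; apply/eqP.
by apply: h; rewrite mem_index_enum.
Qed.

Lemma qform_col m n (M : 'M[R[i]]_m) (N : 'M[R[i]]_(m, n)) j :
  qform M (col j N) = complex.Re ((N ^t* *m M *m N) j j).
Proof.
congr complex.Re; rewrite -[in RHS]mulmxA -[in LHS]mulmxA !mxE.
apply: eq_bigr => k _; rewrite !mxE; congr (_ * _).
by apply: eq_bigr => l _; rewrite !mxE.
Qed.

Lemma psd_gram m n (N : 'M[R[i]]_(m, n)) : psd (N ^t* *m N).
Proof.
move=> x; rewrite -[N ^t*]mulmx1 qform_conj qform1.
by apply: sumr_ge0 => *; apply: normsq_ge0.
Qed.

Lemma psd_gramr m n (N : 'M[R[i]]_(m, n)) : psd (N *m N ^t*).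
Proof. by have := psd_gram (N ^t*); rewrite trmxCK. Qed.

Lemma adj_gram m n (N : 'M[R[i]]_(m, n)) : (N *m N ^t*) ^t* = N *m N ^t*.
Proof. by rewrite adjmxM trmxCK. Qed.

Lemma psd_conj m n (M : 'M[R[i]]_m) (N : 'M[R[i]]_(m, n)) :
  psd M -> psd (N ^t* *m M *m N).
Proof. by move=> hM x; rewrite qform_conj. Qed.

Lemma psd_rdiag m (d : 'rV[R]_m) : (forall j, 0 <= d 0 j) -> psd (rdiag d).
Proof.
by move=> h x; rewrite qform_rdiag sumr_ge0 // => j _; rewrite mulr_ge0 ?normsq_ge0.
Qed.

Lemma Re_diag_psd m (M : 'M[R[i]]_m) i : psd M -> 0 <= complex.Re (M i i).
Proof. by move=> /(_ (col i 1%:M)); rewrite qform_col adjmx1 mul1mx mulmx1. Qed.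

Lemma gram_eq0 m n (Z : 'M[R[i]]_(m, n)) : Z ^t* *m Z = 0 -> Z = 0.
Proof.
move=> h; apply/matrixP => i j; rewrite mxE; apply: normsq_eq0; apply/eqP.
have : qform 1%:M (col j Z) = 0 by rewrite qform_col mulmx1 h mxE.
rewrite qform1 => /eqP; rewrite psumr_eq0 => [/allP/(_ i (mem_index_enum _))|*].
  by rewrite mxE.
exact: normsq_ge0.
Qed.

(** The matrix form of 2 |Re (v^* B w)| <= v^* B v + w^* B w for B >= 0, applied to
    the j-th columns of V and W. *)
Lemma psd_polar m (B : 'M[R[i]]_m) n (V W : 'M[R[i]]_(m, n)) j :
  B ^t* = B -> psd B ->
  `|complex.Re ((V ^t* *m B *m W) j j)| *+ 2 <=
  complex.Re ((V ^t* *m B *m V) j j) + complex.Re ((W ^t* *m B *m W) j j).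
Proof.
move=> hB pB.
pose b (P Q : 'M[R[i]]_(m, n)) := complex.Re ((P ^t* *m B *m Q) j j).
have sym : b W V = b V W.
  rewrite /b; have -> : W ^t* *m B *m V = (V ^t* *m B *m W) ^t*.
    by rewrite !adjmxM trmxCK hB mulmxA.
  by rewrite mxE Re_conj mxE.
have bDl P P' Q : b (P + P') Q = b P Q + b P' Q.
  by rewrite /b adjmxD mulmxDl mulmxDl addmxE ReD.
have bDr P Q Q' : b P (Q + Q') = b P Q + b P Q'.
  by rewrite /b mulmxDr addmxE ReD.
have bNr P Q : b P (- Q) = - b P Q by rewrite /b mulmxN oppmxE ReN.
have bNl P Q : b (- P) Q = - b P Q.
  by rewrite /b -[- P]sub0r adjmxB trmx0 map_mx0 sub0r mulNmx mulNmx oppmxE ReN.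
(* B is nonnegative on both v + w and v - w. *)
have hp := pB (col j (V + W)); have hm := pB (col j (V - W)).
rewrite !qform_col -!/(b _ _) in hp hm *.
rewrite bDl !bDr sym in hp; rewrite bDl !bDr bNl !bNr bNl sym in hm.
rewrite -mulr_natr; move: (b V V) (b V W) (b W W) hp hm => x y z.
by case: (ger0P y) => _ hp hm; lra.
Qed.

Definition rtrace m (M : 'M[R[i]]_m) : R := complex.Re (\tr M).

Lemma rtraceD m (M N : 'M[R[i]]_m) : rtrace (M + N) = rtrace M + rtrace N.
Proof. by rewrite /rtrace mxtraceD ReD. Qed.

Lemma rtraceN m (M : 'M[R[i]]_m) : rtrace (- M) = - rtrace M.
Proof. by rewrite /rtrace -ReN; congr complex.Re; rewrite raddfN. Qed.

Lemma rtraceC m n (M : 'M[R[i]]_(m, n)) (N : 'M[R[i]]_(n, m)) :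
  rtrace (M *m N) = rtrace (N *m M).
Proof. by rewrite /rtrace mxtrace_mulC. Qed.

Lemma rtrace_adj m (M : 'M[R[i]]_m) : rtrace (M ^t*) = rtrace M.
Proof.
rewrite /rtrace /mxtrace !Re_sum; apply: eq_bigr => j _.
by rewrite !mxE Re_conj.
Qed.

Lemma rtrace_rdiagM m (d : 'rV[R]_m) (M : 'M[R[i]]_m) :
  rtrace (rdiag d *m M) = \sum_j d 0 j * complex.Re (M j j).
Proof.
rewrite /rtrace /mxtrace Re_sum; apply: eq_bigr => j _.
by rewrite mul_diag_mx !mxE ReMl.
Qed.

Lemma rtrace_rdiag m (d : 'rV[R]_m) : rtrace (rdiag d) = \sum_j d 0 j.
Proof.
rewrite -[rdiag d]mulmx1 rtrace_rdiagM; apply: eq_bigr => j _.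
by rewrite mxE eqxx mulr1.
Qed.

Lemma rtrace_psd_gram m n (M : 'M[R[i]]_m) (N : 'M[R[i]]_(m, n)) :
  psd M -> 0 <= rtrace (M *m (N *m N ^t*)).
Proof.
move=> hM; rewrite mulmxA rtraceC mulmxA /rtrace Re_sum.
by apply: sumr_ge0 => j _; rewrite -qform_col.
Qed.

Lemma psd_spec m (U : 'M[R[i]]_m) (d : 'rV[R]_m) :
  (forall j, 0 <= d 0 j) -> psd (U *m rdiag d *m U ^t*).
Proof. by move=> /psd_rdiag h; have := psd_conj (U ^t*) h; rewrite trmxCK. Qed.

Lemma adj_spec m (U : 'M[R[i]]_m) (d : 'rV[R]_m) :
  (U *m rdiag d *m U ^t*) ^t* = U *m rdiag d *m U ^t*.
Proof. by rewrite !adjmxM trmxCK adj_rdiag mulmxA. Qed.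

Lemma rtrace_spec m (U : 'M[R[i]]_m) (d : 'rV[R]_m) : U ^t* *m U = 1%:M ->
  rtrace (U *m rdiag d *m U ^t*) = \sum_j d 0 j.
Proof. by move=> hU; rewrite rtraceC mulmxA hU mul1mx rtrace_rdiag. Qed.

(** * Ordered eigenvalues *)

Definition nonincr m (d : 'rV[R]_m) := forall i j : 'I_m, (i <= j)%N -> d 0 j <= d 0 i.

Lemma dsort_reindex m (x : 'rV[R]_m) :
  exists s : 'S_m, forall j, dsort x 0 j = x 0 (s j).
Proof.
have /tuple_permP[s hs] : perm_eq [tuple x 0 j | j < m] (mktuple (fun j => dsort x 0 j)).
  by rewrite perm_sym; exact: dsort_perm.
have {}hs : [tuple x 0 j | j < m] =
   [tuple tnth (mktuple (fun j => dsort x 0 j)) (s i) | i < m] by apply: val_inj.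
exists (s^-1)%g => j.
have := congr1 (fun t => tnth t ((s^-1)%g j)) hs.
by rewrite !tnth_mktuple permKV => ->.
Qed.

Lemma dsort_id m (x : 'rV[R]_m) : nonincr x -> dsort x = x.
Proof.
move=> hx; apply/rowP => i; rewrite mxE sorted_sort.
- by rewrite (nth_map i) ?size_enum_ord // nth_ord_enum.
- by move=> a b c ba cb; exact: le_trans cb ba.
rewrite sorted_map.
have : sorted ltn (map val (enum 'I_m)) by rewrite val_enum_ord iota_ltn_sorted.
rewrite sorted_map; apply: sub_sorted => a b /= /ltnW; exact: hx.
Qed.

Lemma spectral_Lambda m (A : 'M[R[i]]_m) : A ^t* = A ->
  exists2 U : 'M[R[i]]_m, U ^t* *m U = 1%:M & A = U *m rdiag (Lambda A) *m U ^t*.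
Proof.
move=> hA.
have Ah : A \is hermsymmx.
  by apply/is_hermitianmxP; rewrite expr0 scale1r hA.
have /orthomx_spectralP AE := hermitian_normalmx Ah.
have /mxOverP dr := hermitian_spectral_diag_real Ah.
have Pu := spectral_unitarymx A.
rewrite invmx_unitary // in AE.
move/unitarymxP: Pu AE dr; rewrite /Lambda.
move: (spectralmx A) (spectral_diag A) => P d PP AE dr.
have [s hs] := dsort_reindex (\row_j complex.Re (d 0 j)).
move: (dsort _) hs => L hs.
exists (\matrix_(i, j) (P ^t*) i (s j)).
  apply/matrixP => i j; rewrite !mxE.
  transitivity ((P *m P ^t*) (s i) (s j)).
    rewrite mxE; apply: eq_bigr => k _; rewrite !mxE.
    by rewrite conjCK.
  by rewrite PP mxE (inj_eq perm_inj).
rewrite {1}AE; apply/matrixP => i j; rewrite !mxE.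
rewrite (reindex_inj (@perm_inj _ s)) /=; apply: eq_bigr => k _.
rewrite !mul_mx_diag !mxE conjCK hs mxE; congr (_ * _ * _).
by rewrite RRe_real ?dr.
Qed.

Lemma Lambda_nonincr m (A : 'M[R[i]]_m) : nonincr (Lambda A).
Proof. by move=> i j; apply: dsort_nonincr. Qed.

(** A vector in the span of the first j + 1 eigenvectors of A and of the last m - j
    eigenvectors of B, which exists by counting dimensions, compares the Rayleigh
    quotients. The statement is about arbitrary ordered diagonalizations, so that it
    also yields the uniqueness of the ordered spectrum. *)
Lemma weyl_monotonicity m (A B U V : 'M[R[i]]_m) (a b : 'rV[R]_m) :
  U ^t* *m U = 1%:M -> V ^t* *m V = 1%:M ->
  A = U *m rdiag a *m U ^t* -> B = V *m rdiag b *m V ^t* ->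
  nonincr a -> nonincr b -> psd (B - A) ->
  forall j, a 0 j <= b 0 j.
Proof.
move=> hU hV AE BE da db hAB j.
(* The vanishing row j of N makes N singular; a kernel vector x then has no
   component along the eigenvectors of A of index > j, nor along those of B of
   index < j. *)
pose N : 'M[R[i]]_m := \matrix_(i, k) (if (j < i)%N then (U ^t*) i k
                           else if (i < j)%N then (V ^t*) i k else 0).
have detN : \det N^T == 0.
  rewrite det_tr (expand_det_row _ j) big1 // => k _.
  by rewrite mxE ltnn mul0r.
have [v v0 vN] := det0P detN.
pose x := v^T.
have x0 : x != 0 by rewrite -trmx0 (inj_eq trmx_inj).
have Nx i : \sum_k N i k * x k 0 = 0.
  have /colP/(_ i) : N *m x = 0 by apply: trmx_inj; rewrite trmx_mul trmxK trmx0.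
  by rewrite !mxE.
have xU (i : 'I_m) : (j < i)%N -> (U ^t* *m x) i 0 = 0.
  move=> ji; rewrite -(Nx i) mxE.
  by apply: eq_bigr => k _; rewrite [N _ _]mxE ji.
have xV (i : 'I_m) : (i < j)%N -> (V ^t* *m x) i 0 = 0.
  move=> ij; rewrite -(Nx i) mxE.
  by apply: eq_bigr => k _; rewrite [N _ _]mxE ij ltnNge (ltnW ij).
have qU (W : 'M[R[i]]_m) : W ^t* *m W = 1%:M ->
    \sum_k normsq ((W ^t* *m x) k 0) = qform 1%:M x.
  by move=> hW; rewrite -qform1 -qform_conj trmxCK mulmx1 (mulmx1C hW).
rewrite -(ler_pM2r (qform1_gt0 x0)).
have normsq0 : normsq (0 : R[i]) = 0 by rewrite /normsq expr0n addr0.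
apply: (@le_trans _ _ (qform A x)).
  rewrite AE -{1}[U]trmxCK qform_conj qform_rdiag -(qU U hU) mulr_sumr.
  apply: ler_sum => k _; have [kj|jk] := leqP k j.
    by rewrite ler_wpM2r ?normsq_ge0 ?da.
  by rewrite (xU _ jk) normsq0 !mulr0.
apply: (@le_trans _ _ (qform B x)).
  by rewrite -subr_ge0 -qformN -qformD.
rewrite BE -{1}[V]trmxCK qform_conj qform_rdiag -(qU V hV) mulr_sumr.
apply: ler_sum => k _; have [jk|kj] := leqP j k.
  by rewrite ler_wpM2r ?normsq_ge0 ?db.
by rewrite (xV _ kj) normsq0 !mulr0.
Qed.

Lemma Lambda_uniq m (A U : 'M[R[i]]_m) (a : 'rV[R]_m) :
  U ^t* *m U = 1%:M -> A = U *m rdiag a *m U ^t* -> nonincr a -> Lambda A = a.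
Proof.
move=> hU AE da.
have hA : A ^t* = A by rewrite AE !adjmxM trmxCK adj_rdiag mulmxA.
have [V hV BE] := spectral_Lambda hA.
have p0 : psd (A - A) by rewrite subrr; apply: psd0.
apply/rowP => j; apply/eqP; rewrite eq_le.
by rewrite (weyl_monotonicity hV hU BE AE) ?(weyl_monotonicity hU hV AE BE) //;
  apply: Lambda_nonincr.
Qed.

Lemma Lambda_mono m (A B : 'M[R[i]]_m) : A ^t* = A -> B ^t* = B ->
  psd (B - A) -> forall j, Lambda A 0 j <= Lambda B 0 j.
Proof.
move=> /spectral_Lambda[U hU AE] /spectral_Lambda[V hV BE] hAB.
by apply: (weyl_monotonicity hU hV AE BE) => //; apply: Lambda_nonincr.
Qed.

Lemma Lambda_shift m (A : 'M[R[i]]_m) (t : R) : A ^t* = A ->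
  Lambda (A + rdiag (const_mx t)) = Lambda A + const_mx t.
Proof.
move=> /spectral_Lambda[U hU AE]; apply: (Lambda_uniq hU).
  rewrite -rdiagD mulmxDr mulmxDl -AE; congr (_ + _).
  by rewrite rdiagC -scalemx1 -scalemxAr mulmx1 -scalemxAl (mulmx1C hU).
move=> i j ij; rewrite !addmxE ![const_mx _ _ _]mxE lerD2r.
exact: Lambda_nonincr.
Qed.

Lemma Lambda_conj m (A V : 'M[R[i]]_m) : A ^t* = A -> V ^t* *m V = 1%:M ->
  Lambda (V ^t* *m A *m V) = Lambda A.
Proof.
move=> /spectral_Lambda[U hU AE] hV; apply: (@Lambda_uniq _ _ (V ^t* *m U)).
- by rewrite adjmxM trmxCK mulmxA -[U ^t* *m V *m _]mulmxA (mulmx1C hV) mulmx1.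
- by rewrite {1}AE adjmxM trmxCK !mulmxA.
exact: Lambda_nonincr.
Qed.

Lemma rtrace_Lambda m (A : 'M[R[i]]_m) : A ^t* = A ->
  rtrace A = \sum_j Lambda A 0 j.
Proof.
move=> /spectral_Lambda[U hU AE]; rewrite {1}AE rtraceC mulmxA hU mul1mx.
exact: rtrace_rdiag.
Qed.

(** * Lidskii majorization for absolute differences *)

(** With P the part of A - B above the level t, A <= B + P + t, so the eigenvalues of
    A exceed those of B + t by at most f = Lambda (B + P) - Lambda B, which is
    nonnegative since P >= 0 and sums to the trace of P. *)
Lemma Lambda_excess m (A B U : 'M[R[i]]_m) (d : 'rV[R]_m) (t : R) :
  A ^t* = A -> U ^t* *m U = 1%:M -> A - B = U *m rdiag d *m U ^t* ->
  exists f : 'I_m -> R,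
   [/\ forall j, 0 <= f j,
       forall j, Lambda A 0 j <= Lambda B 0 j + t + f j
     & \sum_j f j = \sum_j Num.max (d 0 j - t) 0].
Proof.
move=> hA hU DE; pose p := \row_j Num.max (d 0 j - t) 0.
pose P := U *m rdiag p *m U ^t*.
have hB : B ^t* = B.
  have BE : B = A - (A - B) by rewrite subKr.
  by rewrite BE adjmxB hA DE adj_spec.
have hBP : (B + P) ^t* = B + P by rewrite adjmxD hB adj_spec.
exists (fun j => Lambda (B + P) 0 j - Lambda B 0 j); split=> [j|j|].
- rewrite subr_ge0; apply: Lambda_mono => //.
  have -> : B + P - B = P by rewrite addrAC subrr add0r.
  by apply: psd_spec => i; rewrite !mxE le_max lexx orbT.
- rewrite addrC addrA subrK.
  have -> : Lambda (B + P) 0 j + t = Lambda (B + P + rdiag (const_mx t)) 0 j.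
    by rewrite Lambda_shift // addmxE [const_mx _ _ _]mxE.
  apply: Lambda_mono => //; first by rewrite adjmxD hBP adj_rdiag.
  have -> : B + P + rdiag (const_mx t) - A =
      U *m rdiag (p + const_mx t - d) *m U ^t*.
    rewrite -rdiagD -rdiagN -rdiagD !mulmxDr !mulmxDl mulmxN mulNmx -DE.
    have -> : U *m rdiag (const_mx t) *m U ^t* = rdiag (const_mx t).
      by rewrite rdiagC -scalemx1 -scalemxAr mulmx1 -scalemxAl (mulmx1C hU).
    by rewrite opprB [RHS]addrA (addrC _ B) addrA.
  apply: psd_spec => i; rewrite !mxE.
  by rewrite subr_ge0 -lerBlDr le_max lexx.
rewrite sumrB -!rtrace_Lambda // rtraceD addrAC subrr add0r rtrace_spec //.
by apply: eq_bigr => j _; rewrite mxE.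
Qed.

Lemma sum_subfamily_le m (s : 'S_m) (k : nat) (f : 'I_m -> R) :
  (forall j, 0 <= f j) -> \sum_(i < m | (i < k)%N) f (s i) <= \sum_j f j.
Proof.
move=> f0; rewrite [leRHS](reindex_inj (@perm_inj _ s)) big_mkcond /=.
by apply: ler_sum => i _; case: ifP.
Qed.

(** Cutting A - B and B - A at the level t of the k-th largest |eigenvalue| of A - B
    reduces any choice of k indices and of signs to a trace computation. *)
Lemma lidskii_majorization m (A B : 'M[R[i]]_m) : A ^t* = A -> B ^t* = B ->
  weak_majorized (\row_j `|Lambda A 0 j - Lambda B 0 j|)
                 (\row_j `|Lambda (A - B) 0 j|).
Proof.
move=> hA hB k /andP[k0 km].
have hD : (A - B) ^t* = A - B by rewrite adjmxB hA hB.
have [U hU DE] := spectral_Lambda hD.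
move: (Lambda (A - B)) DE => d DE.
have DE' : B - A = U *m rdiag (- d) *m U ^t*.
  by rewrite -rdiagN mulmxN mulNmx -DE opprB.
set x := (X in dsort X); set y := (X in _ <= \sum_(i < m | _) dsort X 0 i).
have [s1 hs1] := dsort_reindex x; have [s2 hs2] := dsort_reindex y.
have km1 : (k.-1 < m)%N by rewrite prednK.
pose t := dsort y 0 (Ordinal km1).
have t0 : 0 <= t by rewrite /t hs2 mxE.
have [f [f0 fle fs]] := Lambda_excess t hA hU DE.
have [g [g0 gle gs]] := Lambda_excess t hB hU DE'.
(* Each coordinate moves by at most t plus the two nonnegative excesses f, g. *)
apply: (@le_trans _ _ (\sum_(i < m | (i < k)%N) (t + f (s1 i) + g (s1 i)))).
  apply: ler_sum => i _; rewrite hs1 mxE; move: (s1 i) => j.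
  rewrite ler_norml; have := fle j; have := gle j; have := f0 j; have := g0 j.
  by move=> *; apply/andP; split; lra.
rewrite !big_split /= -addrA.
have -> : \sum_(i < m | (i < k)%N) dsort y 0 i =
    \sum_(i < m | (i < k)%N) t + \sum_(i < m | (i < k)%N) (dsort y 0 i - t).
  by rewrite -big_split; apply: eq_bigr => i _ /=; rewrite addrCA subrr addr0.
rewrite lerD2l.
apply: le_trans (lerD (sum_subfamily_le _ _ f0) (sum_subfamily_le _ _ g0)) _.
(* As t is the k-th largest entry of y, the total excess over t is exactly
   what the k largest entries of y exceed t by. *)
rewrite fs gs -big_split (reindex_inj (@perm_inj _ s2)) [leRHS]big_mkcond /=.
apply: ler_sum => i _.
have -> : Num.max (d 0 (s2 i) - t) 0 + Num.max ((- d) 0 (s2 i) - t) 0 =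
   Num.max (dsort y 0 i - t) 0.
  rewrite hs2 !mxE; move: (d 0 _) => z.
  have [z0|z0] := leP 0 z.
    rewrite ger0_norm // [X in _ + X]max_r ?addr0 //.
    by rewrite -opprD oppr_le0 addr_ge0.
  rewrite ler0_norm ?ltW // [X in X + _]max_r ?add0r //.
  by rewrite subr_le0 (le_trans (ltW z0)).
case: ifP => ik.
  rewrite max_l // subr_ge0; apply: dsort_nonincr.
  by rewrite /= -ltnS prednK.
rewrite max_r // subr_le0; apply: dsort_nonincr => /=.
by rewrite (leq_trans (leq_pred _)) // leqNgt ik.
Qed.

(** * The Lyapunov equation with a diagonal coefficient *)

(** The solution B of S B + B S = W for S the diagonal matrix of d. *)
Definition lyap m (d : 'rV[R]_m) (W : 'M[R[i]]_m) : 'M[R[i]]_m :=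
  \matrix_(i, j) (W i j / (d 0 i + d 0 j)%:C).

Lemma lyapK m (d : 'rV[R]_m) W : (forall j, 0 < d 0 j) ->
  rdiag d *m lyap d W + lyap d W *m rdiag d = W.
Proof.
move=> d0; apply/matrixP => i j.
rewrite addmxE mul_diag_mx mul_mx_diag !mxE mulrC -mulrDr -rmorphD /= mulfVK //.
by rewrite -(rmorph0 (real_complex R)) (inj_eq (@complexI R)) gt_eqF ?addr_gt0.
Qed.

Lemma adj_lyap m (d : 'rV[R]_m) W : (lyap d W) ^t* = lyap d (W ^t*).
Proof.
apply/matrixP => i j; rewrite !mxE rmorphM fmorphV [d 0 j + _]addrC; congr (_ / _).
exact: conjc_real.
Qed.

Lemma lyapD m (d : 'rV[R]_m) W W' : lyap d (W + W') = lyap d W + lyap d W'.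
Proof. by apply/matrixP => i j; rewrite !mxE mulrDl. Qed.

Lemma lyapN m (d : 'rV[R]_m) W : lyap d (- W) = - lyap d W.
Proof. by apply/matrixP => i j; rewrite !mxE mulNr. Qed.

Lemma rtrace_lyapC m (d : 'rV[R]_m) W W' :
  rtrace (lyap d W *m W') = rtrace (W *m lyap d W').
Proof.
rewrite /rtrace /mxtrace; congr complex.Re; apply: eq_bigr => i _; rewrite !mxE.
by apply: eq_bigr => j _; rewrite !mxE [d 0 j + _]addrC mulrA mulrAC.
Qed.

Lemma lyap1 m (d : 'rV[R]_m) :
  lyap d 1%:M = rdiag (\row_j (d 0 j + d 0 j)^-1).
Proof.
apply/matrixP => i j; rewrite rdiagE !mxE; case: eqP => [->|_].
  by rewrite mul1r fmorphV.
by rewrite mul0r.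
Qed.

(** An eigenvector x of B with eigenvalue b satisfies x^* W x = 2 b x^* S x, where
    x^* S x > 0; so b cannot be negative. Equivalently, entrywise product
    with the Cauchy matrix 1 / (d i + d j) preserves positivity. *)
Lemma psd_lyap m (d : 'rV[R]_m) W : (forall j, 0 < d 0 j) ->
  W ^t* = W -> psd W -> psd (lyap d W).
Proof.
move=> d0 hW pW; have hB : (lyap d W) ^t* = lyap d W by rewrite adj_lyap hW.
have [U hU BE] := spectral_Lambda hB; move: (Lambda _) BE => b BE.
rewrite BE; apply: psd_spec => j; rewrite leNgt; apply/negP => bj.
(* Testing W on an eigenvector for b j < 0 gives 2 * b j times a positive
   number. *)
have := pW (col j U); rewrite qform_col.
have -> : U ^t* *m W *m U =
  (U ^t* *m rdiag d *m U) *m rdiag b + rdiag b *m (U ^t* *m rdiag d *m U).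
  rewrite -{1}(lyapK W d0) BE mulmxDr mulmxDl; congr (_ + _).
    by rewrite -!mulmxA hU mulmx1.
  by rewrite !mulmxA hU mul1mx.
have := qform_col (rdiag d) U j; move: (_ *m U) => G GE.
rewrite addmxE mul_mx_diag mul_diag_mx !mxE mulrC ReD ReMl -GE.
rewrite -mulr2n pmulrn_lge0 // leNgt nmulr_rlt0 // => /negP; apply.
have x1 : qform 1%:M (col j U) = 1 by rewrite qform_col mulmx1 hU mxE eqxx.
have q0 : 0 <= qform (rdiag d) (col j U) by apply: psd_rdiag => k; exact: ltW.
rewrite lt_neqAle q0 andbT.
apply/negP => /eqP/esym/eqP; rewrite qform_rdiag psumr_eq0 => [/allP h|k _]; last first.
  by rewrite mulr_ge0 ?normsq_ge0 ?ltW.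
have /eqP := x1; rewrite qform1 big1 ?(eq_sym 0) ?oner_eq0 // => k _; apply/eqP.
by have := h k (mem_index_enum _); rewrite mulf_eq0 gt_eqF.
Qed.

Definition partial_isometry m n (N : 'M[R[i]]_(m, n)) := N *m (N ^t* *m N) = N.

(** N N^* is then an orthogonal projection, and so is its complement. *)
Lemma psd_proj_compl m n (N : 'M[R[i]]_(m, n)) :
  partial_isometry N -> psd (1%:M - N *m N ^t*).
Proof.
move=> h; have <- : (1%:M - N *m N ^t*) ^t* *m (1%:M - N *m N ^t*)
    = 1%:M - N *m N ^t*; last exact: psd_gram.
rewrite adjmxB adjmx1 adjmxM trmxCK mulmxBl mul1mx mulmxBr mulmx1.
by rewrite mulmxA -[N *m N ^t* *m N]mulmxA h subrr subr0.
Qed.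

Lemma partial_isometry_rdiag m n (U : 'M[R[i]]_(m, n)) (f e : 'rV[R]_n) :
  U ^t* *m U = rdiag f -> U *m rdiag f = U -> (forall j, e 0 j * e 0 j = e 0 j) ->
  partial_isometry (U *m rdiag e) /\
  rtrace ((U *m rdiag e) *m (U *m rdiag e) ^t*) = \sum_j e 0 j * f 0 j.
Proof.
move=> hU hf he.
have ee : rdiag e *m rdiag e = rdiag e.
  by rewrite rdiagM; congr rdiag; apply/rowP => j; rewrite mxE.
have ef : rdiag e *m rdiag f = rdiag f *m rdiag e.
  by rewrite !rdiagM; congr rdiag; apply/rowP => j; rewrite !mxE mulrC.
have NN : (U *m rdiag e) ^t* *m (U *m rdiag e) = rdiag f *m rdiag e.
  by rewrite adjmxM adj_rdiag -mulmxA [U ^t* *m (_ *m _)]mulmxA hU mulmxA ef -mulmxA ee.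
split.
  by rewrite /partial_isometry NN -mulmxA [rdiag e *m _]mulmxA ef
             -[_ *m _ *m rdiag e]mulmxA ee mulmxA hf.
rewrite rtraceC NN rdiagM rtrace_rdiag.
by apply: eq_bigr => j _; rewrite mxE mulrC.
Qed.

(** A linear functional on the polytope of the vectors in [0, 1]^m with sum at most k
    is largest on the indicator of the first k indices, if the weights decrease. The
    sum of the indicators stands for min k m. *)
Lemma sum_weighted_le_top m (t q : 'I_m -> R) (k : nat) :
  (forall i, 0 <= t i) -> (forall i j : 'I_m, (i <= j)%N -> t j <= t i) ->
  (forall i, 0 <= q i <= 1) -> \sum_i q i <= \sum_(i < m) (i < k)%:R ->
  \sum_i t i * q i <= \sum_(i < m) (i < k)%:R * t i.
Proof.
move=> t0 dt hq hs.
(* c is the first weight left out by the optimal choice of q. *)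
pose c := if insub k is Some j then t j else 0.
have c0 : 0 <= c by rewrite /c; case: insubP.
have hc (i : 'I_m) : (q i - (i < k)%:R) * (t i - c) <= 0.
  have /andP[q0 q1] := hq i; rewrite /c; case: insubP => [j _ jk|km].
    have [ik|ki] := ltnP i k.
      by rewrite mulr_le0_ge0 ?subr_le0 ?subr_ge0 ?dt // jk ltnW.
    by rewrite mulr_ge0_le0 ?subr0 ?subr_le0 ?dt // jk.
  have ik : (i < k)%N by rewrite (leq_trans (ltn_ord i)) // leqNgt.
  by rewrite ik mulr_le0_ge0 ?subr_le0 ?subr0.
rewrite -subr_le0 -sumrB; apply: (@le_trans _ _ (\sum_(i < m) c * (q i - (i < k)%:R))).
  by apply: ler_sum => i _; have := hc i; lra.
by rewrite -mulr_sumr sumrB mulr_ge0_le0 // subr_le0.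
Qed.

(** Since N N^* <= 1, positivity of the Lyapunov solution reduces to N N^* = 1, where
    the solution is the diagonal matrix 1 / (2 d); its trace against a projection of
    rank k is at most the sum of its k largest diagonal entries. By rtrace_lyapC the
    roles of N and N' can be exchanged. *)
Lemma lyap_trace_le m n n' (d : 'rV[R]_m) (N : 'M[R[i]]_(m, n))
    (N' : 'M[R[i]]_(m, n')) (k : nat) :
  (forall j, 0 < d 0 j) -> (forall i j : 'I_m, (i <= j)%N -> d 0 i <= d 0 j) ->
  partial_isometry N -> partial_isometry N' ->
  rtrace (N' *m N' ^t*) <= \sum_(i < m) (i < k)%:R ->
  rtrace (lyap d (N *m N ^t*) *m (N' *m N' ^t*)) *+ 2 <=
    \sum_(i < m) (i < k)%:R * (d 0 i)^-1.
Proof.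
move=> d0 dd hN hN' hk.
have pN := psd_proj_compl hN.
have /(rtrace_psd_gram N') : psd (lyap d (1%:M - N *m N ^t*)).
  by apply: psd_lyap => //; rewrite adjmxB adjmx1 adj_gram.
rewrite lyapD lyapN mulmxBl rtraceD rtraceN subr_ge0 => h.
apply: (@le_trans _ _ (rtrace (lyap d 1%:M *m (N' *m N' ^t*)) *+ 2)).
  by rewrite lerMn2r.
rewrite lyap1 rtrace_rdiagM -sumrMnl.
have -> : \sum_i ((\row_j (d 0 j + d 0 j)^-1) 0 i * complex.Re ((N' *m N' ^t*) i i)) *+ 2
   = \sum_i (d 0 i)^-1 * complex.Re ((N' *m N' ^t*) i i).
  apply: eq_bigr => i _; rewrite mxE -mulrnAl; congr (_ * _).
  by rewrite -mulr_natr -mulr2n -mulr_natr; field; rewrite gt_eqF.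
apply: sum_weighted_le_top => [i|i j ij|i|].
- by rewrite invr_ge0 ltW.
- by rewrite lef_pV2 ?posrE ?dd.
- rewrite Re_diag_psd /=; last exact: psd_gramr.
  have := Re_diag_psd i (psd_proj_compl hN').
  by rewrite addmxE ReD !mxE eqxx /= ReN subr_ge0.
by move: hk; rewrite /rtrace Re_sum.
Qed.

(** * Singular values *)

Lemma singvalsE m p (E : 'M[R[i]]_(m, p)) j :
  singvals E 0 j = Num.sqrt (Lambda (E ^t* *m E) 0 j).
Proof.
rewrite /singvals dsort_id; first by rewrite row_fnE.
by move=> i k ik; rewrite row_fnE [leRHS]row_fnE ler_wsqrtr // Lambda_nonincr.
Qed.

Lemma singvals_ge0 m p (E : 'M[R[i]]_(m, p)) j : 0 <= singvals E 0 j.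
Proof. by rewrite singvalsE sqrtr_ge0. Qed.

Lemma gram_decomp m p (E : 'M[R[i]]_(m, p)) :
  exists2 V : 'M[R[i]]_p, V ^t* *m V = 1%:M &
   (E *m V) ^t* *m (E *m V) =
     rdiag (\row_j (singvals E 0 j * singvals E 0 j)).
Proof.
have hG : (E ^t* *m E) ^t* = E ^t* *m E by rewrite adjmxM trmxCK.
have [V hV GE] := spectral_Lambda hG; exists V => //.
have VGV : V ^t* *m (E ^t* *m E) *m V = rdiag (Lambda (E ^t* *m E)).
  by rewrite {1}GE -!mulmxA hV mulmx1 mulmxA hV mul1mx.
rewrite adjmxM -mulmxA [E ^t* *m _]mulmxA [LHS]mulmxA VGV; congr rdiag.
apply/rowP => j; rewrite [RHS]mxE singvalsE -expr2 sqr_sqrtr //.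
have -> : Lambda (E ^t* *m E) 0 j = complex.Re ((V ^t* *m (E ^t* *m E) *m V) j j).
  by rewrite VGV rdiagE eqxx.
by rewrite -qform_col; apply: psd_gram.
Qed.

(** Normalizing the nonzero columns of E V, and leaving the zero ones, gives a partial
    isometry U for every E, rectangular or of deficient rank. *)
Lemma thin_svd m p (E : 'M[R[i]]_(m, p)) :
  exists (U : 'M[R[i]]_(m, p)) (V : 'M[R[i]]_p) (f : 'rV[R]_p),
  [/\ E = U *m rdiag (singvals E) *m V ^t*,
      V ^t* *m V = 1%:M, U ^t* *m U = rdiag f, U *m rdiag f = U
    & forall j, f 0 j <= 1].
Proof.
have [V hV hG] := gram_decomp E.
move: (singvals E) hG => s hG.
(* The inverse of 0 is 0, so that U has a zero column wherever the singular
   value vanishes. *)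
pose si := \row_j (s 0 j)^-1; pose f := \row_j (s 0 j != 0)%:R : 'rV[R]_p.
have siE j : s 0 j * (s 0 j)^-1 = (s 0 j != 0)%:R.
  by case: eqP => [->|/eqP h]; rewrite ?mul0r // mulfV.
have sif : rdiag si *m rdiag f = rdiag si.
  rewrite rdiagM; congr rdiag; apply/rowP => j; rewrite !mxE.
  by case: eqP => [->|_]; rewrite ?mulr1 // invr0 mul0r.
have sis : rdiag si *m rdiag s = rdiag f.
  by rewrite rdiagM; congr rdiag; apply/rowP => j; rewrite !mxE mulrC siE.
exists (E *m V *m rdiag si), V, f; split => //.
- apply/eqP; rewrite -subr_eq0; apply/eqP.
  set Z := E *m V *m (1%:M - rdiag f).
  have -> : E - E *m V *m rdiag si *m rdiag s *m V ^t* = Z *m V ^t*.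
    rewrite /Z mulmxBr mulmx1 mulmxBl -[E *m V *m V ^t*]mulmxA (mulmx1C hV) mulmx1.
    by rewrite -[E *m V *m rdiag si *m _]mulmxA sis.
  rewrite [Z]gram_eq0 ?mul0mx // /Z adjmxM adjmxB adjmx1 adj_rdiag.
  rewrite -mulmxA [(E *m V) ^t* *m _]mulmxA hG -rdiag1 rdiagN rdiagD !rdiagM.
  apply/matrixP => i j; rewrite rdiagE !mxE.
  by case: (s 0 j =P 0) => [->|_]; rewrite /= ?subrr ?mul0r ?mulr0 ?mul0rn // mul0rn.
- rewrite adjmxM adj_rdiag -mulmxA [(E *m V) ^t* *m _]mulmxA hG !rdiagM.
  congr rdiag; apply/rowP => j; rewrite !mxE.
  rewrite -mulrA siE mulrA [_^-1 * _]mulrC siE.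
  by rewrite -natrM mulnb andbb.
- by rewrite -mulmxA sif.
by move=> j; rewrite mxE lern1 leq_b1.
Qed.

Lemma singvals_gram m m' p (E : 'M[R[i]]_(m, p)) (F : 'M[R[i]]_(m', p)) :
  E ^t* *m E = F ^t* *m F -> singvals E = singvals F.
Proof. by rewrite /singvals => ->. Qed.

Lemma singvalsN m p (E : 'M[R[i]]_(m, p)) : singvals (- E) = singvals E.
Proof.
apply: singvals_gram; have -> : (- E) ^t* = - E ^t*.
  by rewrite -[- E]sub0r adjmxB trmx0 map_mx0 sub0r.
by rewrite mulmxN mulNmx opprK.
Qed.

Lemma singvals_unitary m p (F : 'M[R[i]]_(m, p)) (P : 'M[R[i]]_m) (Q : 'M[R[i]]_p) :
  P ^t* *m P = 1%:M -> Q ^t* *m Q = 1%:M -> singvals (P ^t* *m F *m Q) = singvals F.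
Proof.
move=> hP hQ.
have -> : singvals F = dsort (\row_j Num.sqrt (Lambda (F ^t* *m F) 0 j)) by [].
rewrite -(Lambda_conj (A := F ^t* *m F) _ hQ); last by rewrite adjmxM trmxCK.
rewrite /singvals; congr (dsort _); apply/rowP => j; rewrite row_fnE [RHS]row_fnE.
congr (Num.sqrt (Lambda _ 0 j)).
rewrite !adjmxM trmxCK -!mulmxA; congr (_ *m (_ *m _)).
by rewrite !mulmxA (mulmx1C hP) mul1mx.
Qed.

Lemma singvals0 m p : singvals (0 : 'M[R[i]]_(m, p)) = 0.
Proof.
apply/rowP => j; rewrite singvalsE mulmx0.
have U1 : (1%:M : 'M[R[i]]_p) ^t* *m 1%:M = 1%:M by rewrite adjmx1 mulmx1.
rewrite (Lambda_uniq (a := 0) U1); first by rewrite mxE sqrtr0.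
  by rewrite mul1mx adjmx1 mulmx1 /rdiag map_mx0 linear0.
by move=> a b _; rewrite !mxE.
Qed.

Lemma singvals_orth_proj n p q (X : 'M[R[i]]_(n, p)) (Z : 'M[R[i]]_(n, q)) :
  orthonormal_cols X -> singvals (orth_proj X *m Z) = singvals (X ^t* *m Z).
Proof.
move=> hX; apply: singvals_gram; rewrite orth_projE // !adjmxM trmxCK -!mulmxA.
by rewrite [X ^t* *m (X *m _)]mulmxA hX mul1mx.
Qed.

(** * Perturbation of the Sylvester equation *)

(** Abel summation: a nonnegative decreasing s is a nonnegative combination of
    indicators of initial segments. *)
Lemma abel_le m (s x y : 'I_m -> R) :
  (forall i, 0 <= s i) -> (forall i j : 'I_m, (i <= j)%N -> s j <= s i) ->
  (forall k : nat, \sum_(i < m) (i < k)%:R * x i <= \sum_(i < m) (i < k)%:R * y i) ->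
  \sum_i s i * x i <= \sum_i s i * y i.
Proof.
elim: m s x y => [|m IH] s x y s0 ds h; first by rewrite !big_ord0.
pose c := s ord_max.
have hm : \sum_i x i <= \sum_i y i.
  have := h m.+1; under eq_bigr => i _ do rewrite ltn_ord mul1r.
  by under [X in _ <= X]eq_bigr => i _ do rewrite ltn_ord mul1r.
(* Subtracting the smallest weight c reduces to the first m terms. *)
have spl z : \sum_(i < m.+1) s i * z i =
    \sum_(i < m) (s (widen_ord (leqnSn m) i) - c) * z (widen_ord (leqnSn m) i)
    + c * \sum_i z i.
  rewrite mulr_sumr !big_ord_recr /= addrA -big_split /=; congr (_ + _).
  by apply: eq_bigr => i _; rewrite -mulrDl subrK.
rewrite !spl lerD ?ler_wpM2l //; last exact: s0.
apply: (IH (fun i => s (widen_ord _ i) - c) (fun i => x (widen_ord _ i))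
           (fun i => y (widen_ord _ i))) => [i|i j ij|k].
- by rewrite subr_ge0 ds //= ltnW.
- by rewrite lerD2r ds.
have key z : \sum_(i < m) (i < k)%:R * z (widen_ord (leqnSn m) i) =
   \sum_(i < m.+1) (i < minn k m)%:R * z i :> R.
  rewrite big_ord_recr /= [X in _ + X * _](_ : _ = 0) ?mul0r ?addr0; last first.
    by rewrite leq_min ltnn andbF.
  by apply: eq_bigr => i _; rewrite leq_min ltn_ord andbT.
by rewrite !key.
Qed.

(** Writing E = sum_j s_j u_j v_j^*, each term 2 Re (v_j^* B1 u_j - v_j^* B2 u_j) is at
    most v_j^* B v_j + u_j^* B u_j with B = B1 + B2. The partial sum of these numbers
    over j < l is the sum of two traces of B against projections of rank at most l,
    hence at most the sum of 1 / d i over i < min k l. As the s_j decrease, Abel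
    summation concludes. *)
Lemma lyap_trace_bound m (d : 'rV[R]_m) (E N N1 N2 : 'M[R[i]]_m) (k : nat) :
  (forall j, 0 < d 0 j) -> (forall i j : 'I_m, (i <= j)%N -> d 0 i <= d 0 j) ->
  partial_isometry N -> N *m N ^t* = N1 *m N1 ^t* + N2 *m N2 ^t* ->
  rtrace (N *m N ^t*) <= \sum_(i < m) (i < k)%:R ->
  rtrace (E *m (lyap d (N1 *m N1 ^t*) - lyap d (N2 *m N2 ^t*))) *+ 2 <=
  \sum_(i < m) (i < k)%:R * (singvals E 0 i / d 0 i).
Proof.
move=> d0 dd hN NE hk.
have [U [V [f [EE hV hU hf f1]]]] := thin_svd E.
set B := lyap d (N *m N ^t*).
set B1 := lyap d (N1 *m N1 ^t*); set B2 := lyap d (N2 *m N2 ^t*).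
have BE : B = B1 + B2 by rewrite /B NE lyapD.
have hB1 : B1 ^t* = B1 by rewrite adj_lyap adj_gram.
have hB2 : B2 ^t* = B2 by rewrite adj_lyap adj_gram.
have pB1 : psd B1 := psd_lyap d0 (adj_gram N1) (@psd_gramr _ _ N1).
have pB2 : psd B2 := psd_lyap d0 (adj_gram N2) (@psd_gramr _ _ N2).
have [q qE] : exists q : 'M[R[i]]_m -> 'M[R[i]]_m -> 'M[R[i]]_m -> 'I_m -> R,
    forall C W W' j, q C W W' j = complex.Re ((W ^t* *m C *m W') j j).
  by exists (fun C W W' j => complex.Re ((W ^t* *m C *m W') j j)).
have qD W W' j : q B W W' j = q B1 W W' j + q B2 W W' j.
  by rewrite !qE BE mulmxDr mulmxDl addmxE ReD.
pose diagRe W := q B W W.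
pose x j := diagRe V j + diagRe U j.
apply: (@le_trans _ _ (\sum_j singvals E 0 j * x j)).
  have -> : rtrace (E *m (B1 - B2)) = \sum_j singvals E 0 j * (q B1 V U j - q B2 V U j).
    rewrite {1}EE -!mulmxA rtraceC -!mulmxA rtrace_rdiagM.
    apply: eq_bigr => j _; congr (_ * _).
    by rewrite !qE mulmxA mulmxBr mulmxBl addmxE oppmxE ReD ReN.
  rewrite -sumrMnl; apply: ler_sum => j _; rewrite -mulrnAr ler_wpM2l ?singvals_ge0 //.
  rewrite /x /diagRe (qD V V) (qD U U).
  have h1 : `|q B1 V U j| *+ 2 <= q B1 V V j + q B1 U U j .
    by rewrite !qE; exact: psd_polar.
  have h2 : `|q B2 V U j| *+ 2 <= q B2 V V j + q B2 U U j .
    by rewrite !qE; exact: psd_polar.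
  rewrite !mulr2n in h1 h2 *.
  have := ler_norm (q B1 V U j); have := ler_norm (- q B2 V U j); rewrite normrN.
  move: `|q B1 V U j| `|q B2 V U j| h1 h2.
  move: (q B1 V U j) (q B2 V U j) (q B1 V V j) (q B2 V V j) (q B1 U U j) (q B2 U U j).
  by move=> *; lra.
have -> : \sum_(i < m) (i < k)%:R * (singvals E 0 i / d 0 i) =
   \sum_i singvals E 0 i * ((i < k)%:R * (d 0 i)^-1).
  by apply: eq_bigr => i _; rewrite mulrCA.
(* Abel summation leaves partial sums, that is traces of B against the partial
   isometries formed by the first l columns of V and of U. *)
apply: abel_le => [i|i j ij|l].
- exact: singvals_ge0.
- exact: dsort_nonincr.
have half (W : 'M[R[i]]_m) g : W ^t* *m W = rdiag g -> W *m rdiag g = W ->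
   (forall j, g 0 j <= 1) ->
   (\sum_(i < m) (i < l)%:R * diagRe W i) *+ 2 <=
   \sum_(i < m) (i < l)%:R * ((i < k)%:R * (d 0 i)^-1).
  move=> hW hg g1; pose e : 'rV[R]_m := \row_i (i < l)%:R.
  have ee j : e 0 j * e 0 j = e 0 j by rewrite mxE -natrM mulnb andbb.
  have [pN' tN'] := partial_isometry_rdiag hW hg ee.
  set N' := W *m rdiag e in pN' tN'.
  have -> : \sum_(i < m) (i < l)%:R * diagRe W i = rtrace (B *m (N' *m N' ^t*)).
    rewrite /N' adjmxM adj_rdiag -mulmxA [rdiag e *m (_ *m _)]mulmxA rdiagM.
    rewrite [RHS]rtraceC -!mulmxA rtraceC -!mulmxA rtrace_rdiagM.
    by apply: eq_bigr => j _; rewrite row_fnE ee row_fnE /diagRe qE mulmxA.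
  have tl : rtrace (N' *m N' ^t*) <= \sum_(i < m) (i < l)%:R.
    rewrite tN'; apply: ler_sum => i _; rewrite mxE.
    by rewrite ler_piMr ?ler0n.
  have h1 := lyap_trace_le d0 dd hN pN' tl.
  have h2 := lyap_trace_le d0 dd pN' hN hk.
  rewrite rtrace_lyapC rtraceC -/B in h2.
  have [lk|kl] := leqP l k.
    apply: le_trans h1 _; apply: ler_sum => i _; case: ltnP => il; rewrite ?mul0r //.
    by rewrite (leq_trans il lk) !mul1r.
  apply: le_trans h2 _; apply: ler_sum => i _; case: ltnP => ik; rewrite ?mul0r ?mulr0 //.
  by rewrite (ltn_trans ik kl) !mul1r.
have hV' : V ^t* *m V = rdiag (const_mx 1) by rewrite rdiag1.
have hVg : V *m rdiag (const_mx 1) = V by rewrite rdiag1 mulmx1.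
have g1 j : (const_mx 1 : 'rV[R]_m) 0 j <= 1 by rewrite mxE.
have gV := half V _ hV' hVg g1; have gU := half U _ hU hf f1.
under eq_bigr => i _ do rewrite mulrDr.
rewrite big_split /=; move: gV gU; rewrite !mulr2n.
by move: (\sum_i _) (\sum_i _) (\sum_i _) => a b c; lra.
Qed.

(** Ky Fan duality: the sum of the k largest |eigenvalues| of D is the trace of D
    against P1 - P2, where P1 and P2 project on the eigenvectors for the nonnegative
    and the negative ones among these k eigenvalues, and P1 + P2 = N N^*. *)
Lemma kyfan_witness m (D : 'M[R[i]]_m) (k : nat) : D ^t* = D -> (k <= m)%N ->
  exists N N1 N2 : 'M[R[i]]_m,
  [/\ partial_isometry N, N *m N ^t* = N1 *m N1 ^t* + N2 *m N2 ^t*,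
      rtrace (N *m N ^t*) <= \sum_(i < m) (i < k)%:R &
      rtrace (D *m (N1 *m N1 ^t* - N2 *m N2 ^t*)) =
      \sum_(i < m | (i < k)%N) dsort (\row_j `|Lambda D 0 j|) 0 i].
Proof.
move=> hD km; have [T hT DE] := spectral_Lambda hD.
move: (Lambda D) DE => d DE.
have [s hs] := dsort_reindex (\row_j `|d 0 j|).
(* e selects the indices of the k largest |eigenvalues|; e1 and e2 split it
   according to the sign. *)
pose e : 'rV[R]_m := \row_j ((s^-1)%g j < k)%:R.
pose e1 : 'rV[R]_m := \row_j (((s^-1)%g j < k)%N && (0 <= d 0 j))%:R.
pose e2 : 'rV[R]_m := \row_j (((s^-1)%g j < k)%N && (d 0 j < 0))%:R.
have ee j : e 0 j * e 0 j = e 0 j by rewrite mxE -natrM mulnb andbb.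
have ee1 j : e1 0 j * e1 0 j = e1 0 j by rewrite mxE -natrM mulnb andbb.
have ee2 j : e2 0 j * e2 0 j = e2 0 j by rewrite mxE -natrM mulnb andbb.
have gramE (g : 'rV[R]_m) : (forall j, g 0 j * g 0 j = g 0 j) ->
   (T *m rdiag g) *m (T *m rdiag g) ^t* = T *m rdiag g *m T ^t*.
  move=> gg; rewrite adjmxM adj_rdiag -mulmxA [rdiag g *m (_ *m _)]mulmxA rdiagM.
  by rewrite mulmxA; congr (_ *m rdiag _ *m _); apply/rowP => j; rewrite mxE gg.
have hT' : T ^t* *m T = rdiag (const_mx 1) by rewrite rdiag1.
have hTg : T *m rdiag (const_mx 1) = T by rewrite rdiag1 mulmx1.
have [pN tN] := partial_isometry_rdiag hT' hTg ee.
exists (T *m rdiag e), (T *m rdiag e1), (T *m rdiag e2); split=> //.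
- rewrite !gramE // -mulmxDl -mulmxDr rdiagD; congr (_ *m rdiag _ *m _).
  apply/rowP => j; rewrite !mxE -natrD; congr _%:R.
  by case: (_ < k)%N; case: ltP.
- rewrite tN (reindex_inj (@perm_inj _ s)) /=.
  by apply: ler_sum => i _; rewrite !mxE permK mulr1.
rewrite !gramE // -mulmxBl -mulmxBr rdiagN rdiagD DE.
rewrite -!mulmxA rtraceC -!mulmxA hT mulmx1 [T ^t* *m _]mulmxA hT mul1mx.
rewrite rdiagM rtrace_rdiag (reindex_inj (@perm_inj _ s)) [RHS]big_mkcond /=.
apply: eq_bigr => i _; rewrite hs !mxE permK; case: (i < k)%N => /=; last first.
  by rewrite subrr mulr0.
case: ltP => h; first by rewrite sub0r mulrN mulr1 ltr0_norm.
by rewrite subr0 mulr1 ger0_norm.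
Qed.

(** With S = rdiag d, D = K - H and E = S K - H S one has E + E^* = S D + D S. For the
    W = P1 - P2 of Ky Fan duality and the solution B of S B + B S = W, this gives
    tr (D W) = 2 Re tr (E B), to which the trace bound applies. *)
Lemma sylvester_majorization m (d : 'rV[R]_m) (H K F1 F2 : 'M[R[i]]_m) :
  H ^t* = H -> K ^t* = K ->
  (forall j, 0 < d 0 j) -> (forall i j : 'I_m, (i <= j)%N -> d 0 i <= d 0 j) ->
  rdiag d *m K - H *m rdiag d = F1 ^t* - F2 ->
  forall k, (1 <= k <= m)%N ->
  \sum_(i < m | (i < k)%N) dsort (\row_j `|Lambda H 0 j - Lambda K 0 j|) 0 i <=
  \sum_(i < m | (i < k)%N) (singvals F1 0 i + singvals F2 0 i) / d 0 i.
Proof.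
move=> hH hK d0 dd EE k hk.
have -> : \row_j `|Lambda H 0 j - Lambda K 0 j| = \row_j `|Lambda K 0 j - Lambda H 0 j|.
  by apply/rowP => j; rewrite row_fnE [RHS]row_fnE distrC.
apply: le_trans (lidskii_majorization hK hH hk) _.
have hD : (K - H) ^t* = K - H by rewrite adjmxB hK hH.
have /andP[_ km] := hk.
have [N [N1 [N2 [pN NE tN <-]]]] := kyfan_witness hD km.
set W := N1 *m N1 ^t* - N2 *m N2 ^t*.
have hW : W ^t* = W by rewrite /W adjmxB !adj_gram.
have hB : (lyap d W) ^t* = lyap d W by rewrite adj_lyap hW.
(* Replace W by S B + B S, where S is rdiag d, and move S onto K - H. *)
have -> : rtrace ((K - H) *m W) =
   rtrace (F1 *m lyap d W) *+ 2 + rtrace (- F2 *m lyap d W) *+ 2.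
  rewrite -{1}(lyapK W d0) mulmxDr rtraceD.
  have -> : rtrace ((K - H) *m (lyap d W *m rdiag d)) =
      rtrace (rdiag d *m (K - H) *m lyap d W).
    by rewrite mulmxA rtraceC !mulmxA.
  rewrite mulmxA -rtraceD -mulmxDl.
  have EE' : K *m rdiag d - rdiag d *m H = F1 - F2 ^t*.
    by rewrite -[F1]trmxCK -adjmxB -EE adjmxB !adjmxM adj_rdiag hK hH.
  have -> : (K - H) *m rdiag d + rdiag d *m (K - H) = F1 ^t* - F2 + (F1 - F2 ^t*).
    rewrite -EE -EE' mulmxBl mulmxBr addrC addrACA [RHS]addrACA; congr (_ + _).
    exact: addrC.
  have adjB F : rtrace (F ^t* *m lyap d W) = rtrace (F *m lyap d W).
    by rewrite -rtrace_adj adjmxM trmxCK hB rtraceC.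
  rewrite !mulmxDl !mulNmx !rtraceD !rtraceN !adjB !mulr2n addrACA.
  by [].
have bound F := lyap_trace_bound F d0 dd pN NE tN.
have := lerD (bound F1) (bound (- F2)).
rewrite -!lyapN -!lyapD -/W singvalsN => /le_trans; apply.
rewrite -big_split [leRHS]big_mkcond /=; apply: ler_sum => i _.
by rewrite -mulrDr -mulrDl; case: ifP; rewrite ?mul1r ?mul0r.
Qed.

(** * Principal angles and Ritz values *)

(** The singular values of X^* Y lie in [0, 1] because 1 - X X^* is positive; there
    the cosine inverts acos, so that the squared cosines diagonalize the Gram matrix of
    X^* Y. *)
Lemma Theta_frame n p (X Y : 'M[R[i]]_(n, p)) :
  orthonormal_cols X -> orthonormal_cols Y ->
  exists2 V : 'M[R[i]]_p, V ^t* *m V = 1%:M &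
   (forall j, 0 <= Theta X Y 0 j <= pi) /\
   ((X ^t* *m Y) *m V) ^t* *m ((X ^t* *m Y) *m V) =
   rdiag (\row_j (cos (Theta X Y 0 j) * cos (Theta X Y 0 j))).
Proof.
move=> hX hY; set M := X ^t* *m Y.
have [V hV MV] := gram_decomp M.
have s0 := singvals_ge0 M.
have s1 j : singvals M 0 j <= 1.
  rewrite -(@ler_pXn2r _ 2) ?nnegrE // expr1n expr2.
  have -> : singvals M 0 j * singvals M 0 j =
      complex.Re (((M *m V) ^t* *m (M *m V)) j j).
    by rewrite MV rdiagE eqxx [in RHS]row_fnE.
  have pX : psd (1%:M - X *m X ^t*).
    by apply: psd_proj_compl; rewrite /partial_isometry hX mulmx1.
  have := pX (col j (Y *m V)); rewrite qform_col mulmxBr mulmxBl mulmx1.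
  have -> : (Y *m V) ^t* *m (Y *m V) = 1%:M.
    by rewrite adjmxM -mulmxA [Y ^t* *m _]mulmxA hY mul1mx.
  rewrite addmxE oppmxE ReD ReN mxE eqxx /= subr_ge0.
  by rewrite /M -!mulmxA !adjmxM trmxCK -!mulmxA.
have hs j : singvals M 0 j \in `[(-1), 1].
  by rewrite in_itv /= s1 (le_trans _ (s0 j)) // lerN10.
(* acos reverses the order, hence the reindexing of the columns of V. *)
have [sg hsg] := dsort_reindex (\row_j acos (singvals M 0 j)).
have ThE j : Theta X Y 0 j = acos (singvals M 0 (sg j)).
  by have := hsg j; rewrite row_fnE.
have perm_gram m (N : 'M[R[i]]_(m, p)) i j :
   ((colsub sg N) ^t* *m colsub sg N) i j = (N ^t* *m N) (sg i) (sg j).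
  by rewrite !mxE; apply: eq_bigr => k _; rewrite !mxE.
exists (colsub sg V).
  by apply/matrixP => i j; rewrite perm_gram hV !mxE (inj_eq perm_inj).
split=> [j|].
  by rewrite ThE; have := hs (sg j); rewrite in_itv /= => h; rewrite acos_ge0 ?acos_lepi.
rewrite mulmx_colsub; apply/matrixP => i j; rewrite perm_gram MV !rdiagE.
by rewrite (inj_eq perm_inj) row_fnE [in RHS]row_fnE ThE acosK.
Qed.

Lemma ler_cos_0pi (x y : R) : 0 <= x -> x <= y -> y <= pi -> cos y <= cos x.
Proof.
move=> x0 xy yp.
have xin : x \in `[0, pi] by rewrite in_itv /= x0 (le_trans xy).
have yin : y \in `[0, pi] by rewrite in_itv /= yp (le_trans x0).
by rewrite leNgt ltr_cos // -leNgt.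
Qed.

Lemma cos_theta_ratio_ge1 n p (X Y : 'M[R[i]]_(n, p)) : (0 < p)%N ->
  (forall j, 0 <= Theta X Y 0 j) -> (forall j, Theta X Y 0 j < pi / 2) ->
  1 <= cos (theta_min X Y) / cos (theta_max X Y).
Proof.
move=> p0 T0 Tpi; have pi2 : (0 : R) < pi / 2 by rewrite divr_gt0 ?pi_gt0.
have max_lt : theta_max X Y < pi / 2.
  by rewrite /theta_max; elim/big_ind: _ => // x y hx hy; rewrite gt_max hx.
have min_ge : 0 <= theta_min X Y.
  rewrite /theta_min; elim/big_ind: _ => [|x y hx hy|//]; first exact: ltW.
  by rewrite le_min hx.
have min_le : theta_min X Y <= Theta X Y 0 (Ordinal p0).
  by rewrite /theta_min (bigD1 (Ordinal p0)) //= ge_min lexx.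
have max_ge : Theta X Y 0 (Ordinal p0) <= theta_max X Y.
  by rewrite /theta_max (bigD1 (Ordinal p0)) //= le_max lexx.
have mm := le_trans min_le max_ge.
have cmax : 0 < cos (theta_max X Y).
  apply: cos_gt0_pihalf; rewrite max_lt andbT (lt_le_trans _ (le_trans min_ge mm)) //.
  by rewrite oppr_lt0.
rewrite ler_pdivlMr // mul1r; apply: ler_cos_0pi => //.
apply: le_trans (ltW max_lt) _; rewrite ler_pdivrMr // ler_peMr ?pi_ge0 //.
by rewrite ler1n.
Qed.

Lemma weak_majorized_scale m (x y : 'rV[R]_m) (a : R) :
  (forall k, (1 <= k <= m)%N -> \sum_(i < m | (i < k)%N) dsort x 0 i <=
     \sum_(i < m | (i < k)%N) y 0 i) ->
  (forall j, 0 <= y 0 j) -> nonincr y -> 1 <= a ->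
  weak_majorized x (\row_j (a * y 0 j)).
Proof.
move=> h y0 dy a1 k hk; rewrite (dsort_id (x := \row_j (a * y 0 j))); last first.
  by move=> i j ij; rewrite !row_fnE ler_wpM2l ?dy // (le_trans _ a1).
apply: le_trans (h k hk) _; apply: ler_sum => i _.
by rewrite row_fnE ler_peMl.
Qed.

(** The projected residuals measure how far X^* Y is from intertwining the two
    compressions of A. *)
Lemma residual_sylvester n p (A : 'M[R[i]]_n) (X Y : 'M[R[i]]_(n, p)) :
  A ^t* = A ->
  X ^t* *m Y *m (Y ^t* *m A *m Y) - X ^t* *m A *m X *m (X ^t* *m Y) =
  (Y ^t* *m residual A X) ^t* - X ^t* *m residual A Y.
Proof.
move=> hA; rewrite /residual !mulmxBr adjmxB !adjmxM !trmxCK hA !mulmxA.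
by rewrite opprB [RHS]addrC addrA subrK.
Qed.

(** The matrix V of principal vectors and the unitary U = X^* Y V (cos Theta)^-1 turn
    X^* Y into the diagonal matrix of the cosines without changing eigenvalues or
    singular values. *)
Lemma ritz_values_majorization n p (A : 'M[R[i]]_n) (X Y : 'M[R[i]]_(n, p)) :
  A ^t* = A -> orthonormal_cols X -> orthonormal_cols Y ->
  (forall j : 'I_p, Theta X Y 0 j < pi / 2) ->
  weak_majorized
    (\row_(j < p)
       `|Lambda (X ^t* *m A *m X) 0 j - Lambda (Y ^t* *m A *m Y) 0 j|)
    (\row_(j < p) (Num.sqrt (cos (theta_min X Y) / cos (theta_max X Y)) *
      ((singvals (orth_proj Y *m residual A X) 0 j +
        singvals (orth_proj X *m residual A Y) 0 j) / cos (Theta X Y 0 j)))).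
Proof.
move=> hA hX hY hT.
have [V hV [Tpi MV]] := Theta_frame hX hY.
have T0 j : 0 <= Theta X Y 0 j by have /andP[] := Tpi j.
pose d : 'rV[R]_p := \row_j cos (Theta X Y 0 j).
have d0 j : 0 < d 0 j.
  rewrite row_fnE cos_gt0_pihalf // hT andbT (lt_le_trans _ (T0 j)) //.
  by rewrite oppr_lt0 divr_gt0 ?pi_gt0.
have dd (i j : 'I_p) : (i <= j)%N -> d 0 i <= d 0 j.
  move=> ij; rewrite row_fnE [leRHS]row_fnE; apply: ler_cos_0pi => //;
    last by have /andP[] := Tpi i.
  exact: dsort_nonincr.
have [M ME] : exists M, M = X ^t* *m Y by exists (X ^t* *m Y).
rewrite -ME in MV.
have {}MV : (M *m V) ^t* *m (M *m V) = rdiag d *m rdiag d.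
  by rewrite MV rdiagM; congr rdiag; apply/rowP => j; rewrite !row_fnE.
pose di : 'rV[R]_p := \row_j (d 0 j)^-1.
have did : rdiag di *m rdiag d = 1%:M.
  rewrite rdiagM -rdiag1; congr rdiag; apply/rowP => j.
  by rewrite row_fnE row_fnE [RHS]mxE mulVf // gt_eqF.
(* U is unitary and U^* M V = rdiag d. *)
have [U UE] : exists U, U = M *m V *m rdiag di by exists (M *m V *m rdiag di).
have UM : U ^t* *m M *m V = rdiag d.
  by rewrite UE adjmxM adj_rdiag -!mulmxA MV mulmxA did mul1mx.
have hU : U ^t* *m U = 1%:M by rewrite {2}UE !mulmxA UM; exact: mulmx1C.
have hXA : (X ^t* *m A *m X) ^t* = X ^t* *m A *m X.
  by rewrite !adjmxM trmxCK hA mulmxA.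
have hYA : (Y ^t* *m A *m Y) ^t* = Y ^t* *m A *m Y.
  by rewrite !adjmxM trmxCK hA mulmxA.
rewrite (singvals_orth_proj _ hX) (singvals_orth_proj _ hY).
have := residual_sylvester X Y hA; rewrite -ME.
move: (_ *m residual A X) (_ *m residual A Y) => G1 G2.
move: (X ^t* *m A *m X) (Y ^t* *m A *m Y) hXA hYA => H K hH hK GE.
have SE : rdiag d *m (V ^t* *m K *m V) - (U ^t* *m H *m U) *m rdiag d =
    (V ^t* *m G1 *m U) ^t* - U ^t* *m G2 *m V.
  have -> : (V ^t* *m G1 *m U) ^t* = U ^t* *m G1 ^t* *m V.
    by rewrite !adjmxM trmxCK mulmxA.
  rewrite -mulmxBl -mulmxBr -GE mulmxBr mulmxBl -UM; congr (_ - _).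
    by rewrite -!mulmxA [V *m (V ^t* *m _)]mulmxA (mulmx1C hV) mul1mx.
  by rewrite -!mulmxA [U *m (U ^t* *m _)]mulmxA (mulmx1C hU) mul1mx.
have hH' : (U ^t* *m H *m U) ^t* = U ^t* *m H *m U.
  by rewrite !adjmxM trmxCK hH mulmxA.
have hK' : (V ^t* *m K *m V) ^t* = V ^t* *m K *m V.
  by rewrite !adjmxM trmxCK hK mulmxA.
have main := sylvester_majorization hH' hK' d0 dd SE.
rewrite !Lambda_conj // !singvals_unitary // in main.
move=> k hk.
have p0 : (0 < p)%N by case/andP: hk => k0 kp; exact: leq_trans kp.
pose y : 'rV[R]_p := \row_j ((singvals G1 0 j + singvals G2 0 j) / d 0 j).
have -> : \row_j (Num.sqrt (cos (theta_min X Y) / cos (theta_max X Y)) *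
    ((singvals G1 0 j + singvals G2 0 j) / cos (Theta X Y 0 j))) =
  \row_j (Num.sqrt (cos (theta_min X Y) / cos (theta_max X Y)) * y 0 j).
  by apply/rowP => j; rewrite row_fnE [RHS]row_fnE [y _ _]row_fnE [d _ _]row_fnE.
apply: weak_majorized_scale hk => [l hl|j|i j ij|].
- apply: le_trans (main l hl) _; rewrite le_eqVlt; apply/orP; left; apply/eqP.
  by apply: eq_bigr => i _; rewrite [y _ _]row_fnE.
- by rewrite [y _ _]row_fnE divr_ge0 ?addr_ge0 ?singvals_ge0 // ltW.
- rewrite [y _ i]row_fnE [y _ j]row_fnE ler_pM ?addr_ge0 ?singvals_ge0 ?invr_ge0 //.
  + exact: ltW.
  + by rewrite lerD // dsort_nonincr.
  + by rewrite lef_pV2 ?posrE ?dd.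
by rewrite -[1]sqrtr1 ler_wsqrtr ?cos_theta_ratio_ge1.
Qed.

Lemma residual_invariant n p (A : 'M[R[i]]_n) (X : 'M[R[i]]_(n, p)) :
  orthonormal_cols X -> invariant_colspace A X -> residual A X = 0.
Proof.
move=> hX /submxP[D /(congr1 trmx)]; rewrite trmxK trmx_mul trmxK => E.
by rewrite /residual -mulmxA E [X ^t* *m _]mulmxA hX mul1mx subrr.
Qed.

End RitzMajorization.

Theorem theorem4p3 (R : realType) (n p : nat) (A : 'M[R[i]]_n)
    (X Y : 'M[R[i]]_(n, p)) (hA : A \is hermsymmx)
    (hX : orthonormal_cols X) (hY : orthonormal_cols Y)
    (hTheta : forall j : 'I_p, Theta X Y 0 j < pi / 2) :
  let c := cos (theta_min X Y) / cos (theta_max X Y) in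
  let spectral_diff : 'rV[R]_p := \row_(j < p)
    `|Lambda (X ^t* *m A *m X) 0 j - Lambda (Y ^t* *m A *m Y) 0 j| in
  weak_majorized spectral_diff
    (\row_(j < p) (Num.sqrt c *
      ((singvals (orth_proj Y *m residual A X) 0 j +
        singvals (orth_proj X *m residual A Y) 0 j) / cos (Theta X Y 0 j))))
  /\
  (invariant_colspace A X ->
   weak_majorized spectral_diff
     (\row_(j < p) (Num.sqrt c *
       (singvals (orth_proj X *m residual A Y) 0 j / cos (Theta X Y 0 j))))).
Proof.
have hA' : A ^t* = A.
  by move/is_hermitianmxP: hA; rewrite expr0 scale1r => <-.
move=> c spectral_diff.
have main := ritz_values_majorization hA' hX hY hTheta.
split=> // hinv; move: main; rewrite (residual_invariant hX hinv) mulmx0 singvals0.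
rewrite (_ : (\row_j _) = (\row_(j < p) (Num.sqrt c *
  (singvals (orth_proj X *m residual A Y) 0 j / cos (Theta X Y 0 j))))) //.
by apply/rowP => j; rewrite row_fnE [RHS]row_fnE [_ 0 j]mxE add0r.
Qed.
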